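(* Let $G$ be a group, $R$ a commutative $G$-graded ring with nonzero unity, $M$ a nonzero $G$-graded $R$-module, and $K$ a graded prime $R$-submodule of $M$. Then $K$ is a graded special $r$-submodule of $M$ if and only if $h(M)\cap K\subseteq T(M)$.
   Context: A commutative ring $R$ is $G$-graded if $R=\bigoplus_{g\in G}R_g$ with additive subgroups $R_g$ satisfying $R_gR_h\subseteq R_{gh}$; an $R$-module $M$ is $G$-graded if $M=\bigoplus_{g\in G}M_g$ with additive subgroups $M_g$ satisfying $R_gM_h\subseteq M_{gh}$. Put $h(R)=\bigcup_{g\in G}R_g$ and $h(M)=\bigcup_{g\in G}M_g$. An $R$-submodule $K$ of $M$ is graded if $K=\bigoplus_{g\in G}(K\cap M_g)$. Notation: $(K:_R M)=\{r\in R: rM\subseteq K\}$; $Ann_R(x)=\{r\in R: rx=0\}$ for $x\in M$; $T(M)=\{x\in M: Ann_R(x)\neq\{0\}\}$. A proper graded $R$-submodule $K$ of $M$ is graded prime if whenever $a\in h(R)$, $x\in h(M)$ and $ax\in K$, then $x\in K$ or $a\in (K:_R M)$. A proper graded $R$-submodule $K$ of $M$ is a graded special $r$-submodule if whenever $a\in h(R)$ and $x\in h(M)$ satisfy $ax\in K$ and $Ann_R(x)=\{0\}$, then $a\in(K:_R M)$. *)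

(* Defs.v *)
From HB Require Import structures.
From mathcomp Require Import all_boot all_order all_algebra all_fingroup.
From mathcomp Require Import boolp classical_sets functions cardinality fsbigop.

Set Implicit Arguments.
Unset Strict Implicit.
Unset Printing Implicit Defensive.

Import GRing.Theory.

Local Open Scope classical_set_scope.
Local Open Scope ring_scope.

Section DirectSum.
Variables (G : groupType) (V : zmodType).

Definition finsupp_family (A : G -> set V) (f : G -> V) : Prop :=
  (forall g, A g (f g)) /\ finite_set [set g | f g <> 0].

(* Internal direct sum: the elements of [S] are exactly the sums of finitely
   supported families from [A], and such a family is determined by its sum.
   Finite support must be required explicitly in [finsupp_family]: the
   [\sum_(g \in _)] operator returns 0 on families with infinite support. *)
Definition is_direct_sum (S : set V) (A : G -> set V) : Prop :=
  (forall x, S x <-> exists2 f, finsupp_family A f & x = \sum_(g \in setT) f g)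
  /\ (forall f f', finsupp_family A f -> finsupp_family A f' ->
        \sum_(g \in setT) f g = \sum_(g \in setT) f' g -> f =1 f').

Definition homogeneous (A : G -> set V) : set V := \bigcup_g A g.

End DirectSum.

Record graded_ring (G : groupType) (R : comNzRingType) (Rg : G -> set R)
    : Prop := GradedRing {
  graded_ring_zmod : forall g, zmod_closed (mem (Rg g));
  graded_ring_sum : is_direct_sum setT Rg;
  graded_ring_mul : forall g h a b, Rg g a -> Rg h b -> Rg (g * h)%g (a * b)
}.

Record graded_module (G : groupType) (R : comNzRingType) (Rg : G -> set R)
    (M : lmodType R) (Mg : G -> set M) : Prop := GradedModule {
  graded_module_zmod : forall g, zmod_closed (mem (Mg g));
  graded_module_sum : is_direct_sum setT Mg;
  graded_module_scale :
    forall g h a x, Rg g a -> Mg h x -> Mg (g * h)%g (a *: x)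
}.

Section GradedSubmodules.
Variables (G : groupType) (R : comNzRingType) (M : lmodType R).
Implicit Types (Rg : G -> set R) (Mg : G -> set M) (K : set M).

Definition graded_submodule Mg K : Prop :=
  submod_closed (mem K) /\ is_direct_sum K (fun g => K `&` Mg g).

Definition residual K : set R := [set r | forall m : M, K (r *: m)].

Definition ann (x : M) : set R := [set r | r *: x = 0].

Definition torsion : set M := [set x | ann x <> [set 0]].

Definition graded_prime Rg Mg K : Prop :=
  [/\ graded_submodule Mg K, K <> setT
    & forall a x, homogeneous Rg a -> homogeneous Mg x ->
        K (a *: x) -> K x \/ residual K a].

Definition graded_special_r_submodule Rg Mg K : Prop :=
  [/\ graded_submodule Mg K, K <> setT
    & forall a x, homogeneous Rg a -> homogeneous Mg x ->
        K (a *: x) -> ann x = [set 0] -> residual K a].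

End GradedSubmodules.

Arguments torsion {R} M.

(* Main.v *)
Require Import Defs.
From mathcomp Require Import all_boot all_order all_algebra all_fingroup.
From mathcomp Require Import boolp classical_sets.

(** For the forward implication, suppose that a homogeneous element [x] of [K]
    has zero annihilator. Since [K] is a submodule, [a *: x] lies in [K] for
    every homogeneous [a], so the special r-property puts every homogeneous
    [a] in [residual K]. The residual is closed under addition and every ring
    element is a sum of homogeneous ones, hence [1] is in [residual K], that
    is, [K] is all of [M]: a contradiction. Decomposing [1] in this way avoids
    having to know that [1] is itself homogeneous.

    For the converse, take homogeneous [a] and [x] with [a *: x] in [K] and
    [ann x] zero. Primeness leaves only the case [x] in [K] to exclude, and
    there [x] would be a torsion element, against [ann x] being zero. *)

Import GRing.Theory.

Local Open Scope classical_set_scope.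
Local Open Scope ring_scope.

Lemma submod_closed0 (R : comNzRingType) (M : lmodType R) (K : set M) :
  submod_closed (mem K) -> K 0.
Proof. by case=> K0 _; exact: set_mem K0. Qed.

Lemma submod_closedP (R : comNzRingType) (M : lmodType R) (K : set M) a u v :
  submod_closed (mem K) -> K u -> K v -> K (a *: u + v).
Proof.
by case=> _ KP /mem_set Ku /mem_set Kv; exact: set_mem (KP a u v Ku Kv).
Qed.

Lemma submod_closedZ (R : comNzRingType) (M : lmodType R) (K : set M) a u :
  submod_closed (mem K) -> K u -> K (a *: u).
Proof.
move=> Kmod Ku; rewrite -[a *: u]addr0.
by apply: submod_closedP => //; exact: submod_closed0.
Qed.

Lemma residual0 (R : comNzRingType) (M : lmodType R) (K : set M) :
  submod_closed (mem K) -> residual K 0.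
Proof. by move=> Kmod m; rewrite scale0r; exact: submod_closed0. Qed.

Lemma residualD (R : comNzRingType) (M : lmodType R) (K : set M) a b :
  submod_closed (mem K) -> residual K a -> residual K b -> residual K (a + b).
Proof.
move=> Kmod Ka Kb m; rewrite scalerDl -[a *: m]scale1r.
exact: submod_closedP.
Qed.

Lemma residual1 (R : comNzRingType) (M : lmodType R) (K : set M) :
  residual K 1 -> K = setT.
Proof. by move=> K1; apply/seteqP; split=> // m _; rewrite -[m]scale1r. Qed.

(** Induction along the homogeneous decomposition: it carries [residual K],
    which the special r-property controls only on homogeneous scalars, to [1]. *)
Lemma graded_ring_ind (G : groupType) (R : comNzRingType) (Rg : G -> set R)
    (P : set R) :
  graded_ring Rg -> P 0 -> (forall a b, P a -> P b -> P (a + b)) ->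
  homogeneous Rg `<=` P -> P = setT.
Proof.
move=> [_ [Rsum _] _] P0 PD PRg; apply/seteqP; split=> // r _.
have [f [Rf _] ->] := (Rsum r).1 I.
apply: big_ind => // g _.
by apply: PRg; exists g.
Qed.

Theorem theorem4p10 (G : groupType) (R : comNzRingType) (Rg : G -> set R)
    (M : lmodType R) (Mg : G -> set M) (K : set M)
    (hR : graded_ring Rg) (hM : graded_module Rg Mg)
    (M_neq0 : exists x : M, x <> 0)
    (hK : graded_prime Rg Mg K) :
  graded_special_r_submodule Rg Mg K <-> homogeneous Mg `&` K `<=` torsion M.
Proof.
case: hK => Kgr Kproper Kprime; have [Kmod _] := Kgr; split.
  move=> [_ _ Kspecial] x [Mx Kx] annx.
  apply: Kproper; apply: residual1.
  have -> // : residual K = setT.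
  apply: (graded_ring_ind _ _ _ _ hR) => [|a b|a Ra].
  - exact: residual0.
  - exact: residualD.
  - by apply: (Kspecial a x) => //; exact: submod_closedZ.
move=> Ktors; split=> // a x Ra Mx Kax annx.
have [Kx|//] := Kprime a x Ra Mx Kax.
by case: (Ktors x (conj Mx Kx)).
Qed.
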